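(* Assume that for all $t\in\{0,\dots,T\}$ every finite collection $\{X^\theta\}_{\theta\in\Theta}\subseteq\mathscr L_t(\mathbb R^d)$ admits a supremum with respect to $\preceq^t$, and that the family of models $\Theta$ is $\preceq$-rectangular. Then for every time $t=0,1,\dots,T-1$ and every state $S_t$ we have $$\mathcal B_t(S_t)\preccurlyeq^t\mathcal V_t(S_t),\quad\text{i.e. }\ \mathcal V_t(S_t)\subseteq\mathcal B_t(S_t)+\mathscr L_t(C),$$ as well as $$\mathcal B_t(S_t)\curlyeqprec^t\mathcal V_t(S_t),\quad\text{i.e. }\ \mathcal B_t(S_t)\subseteq\mathcal V_t(S_t)-\mathscr L_t(C).$$
   Context: Probabilistic setting. $(\Omega,\mathscr F)$ is a measurable space, $T\in\mathbb N$, $(\mathscr F_t)_{t=0,\dots,T}$ is the observation filtration, $\Theta\subset\mathbb R^d$ is a non-empty finite set, and $\{\mathbb Q_\theta:\theta\in\Theta\}$ is a family of probability measures on $(\Omega,\mathscr F)$, absolutely continuous with respect to a reference probability measure $\mathbb P$. $\mathbb E^\theta_t$ is the conditional expectation under $\mathbb Q_\theta$ given $\mathscr F_t$. All equalities, inequalities and inclusions are in the $\mathbb P$-a.s. sense. $\mathscr L_t(\mathbb R^d):=L^1(\Omega,\mathscr F_t,\mathbb P;\mathbb R^d)$. Conditional expectations $\mathbb E^\theta_t[X]$, $X\in\mathscr L_s(\mathbb R^d)$, $s\ge t$, are understood to be well-defined elements of $\mathscr L_t(\mathbb R^d)$, determined up to $\mathbb P$-null sets. Order. $\preceq$ is a fixed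 vector preorder on $\mathbb R^d$ (reflexive, transitive, and $x\preceq y$ implies $x+z\preceq y+z$ and $\alpha x\preceq\alpha y$ for $z\in\mathbb R^d$, $\alpha\ge0$), with ordering cone $C=\{x\in\mathbb R^d:0\preceq x\}$ (a convex cone containing $0$). $\mathscr L_t(C)\subseteq\mathscr L_t(\mathbb R^d)$ is the set of elements with values in $C$; for $X,Y\in\mathscr L_t(\mathbb R^d)$, $X\preceq^tY$ iff $Y-X\in\mathscr L_t(C)$. For sets $A,B\subseteq\mathscr L_t(\mathbb R^d)$: $A\preccurlyeq^tB$ iff $B\subseteq A+\mathscr L_t(C)$; $A\curlyeqprec^tB$ iff $A\subseteq B-\mathscr L_t(C)$ (Minkowski sums). Supremum. A supremum of $\{X^\theta\}_{\theta\in\Theta}\subseteq\mathscr L_t(\mathbb R^d)$ with respect to $\preceq^t$ is a $V\in\mathscr L_t(\mathbb R^d)$ such that (i) $X^\theta\preceq^tV$ for all $\theta\in\Theta$, and (ii) if $A\in\mathscr L_t(\mathbb R^d)$ satisfies $X^\theta\preceq^tA$ for all $\theta$, then $V\preceq^tA$. It need not be unique; $\operatorname{v-sup}^t_{\theta\in\Theta}X^\theta$ denotes one arbitrarily chosen supremum (the result holds for any choice). Rectangularity. $\Theta$ is $\preceq$-rectangular if for all $t=0,\dots,T-1$ and all $X\in\mathscr L_T(\mathbb R^d)$, $$\operatorname{v-sup}^t_{\theta\in\Theta}\mathbb E^\theta_t\Big[\operatorname{v-sup}^{t+1}_{\theta'\in\Theta}\mathbb E^{\theta'}_{t+1}[X]\Big]\preceq^t\operatorname{v-sup}^t_{\theta\in\Theta}\mathbb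 E^\theta_t[X].$$ Control setting. $S_{t+1}=F(t,S_t,\varphi_t,Z_{t+1})$, $t=0,\dots,T-1$, $S_0=s$, where $S$ takes values in a measurable space $\mathbb S\subset\mathbb R^m$, $Z$ is an $\mathbb R^k$-valued random sequence, the controls $\varphi_t$ take values in a compact set $A$, and $F$ is measurable. Given the state $S_t$ at time $t$, $\mathfrak A_t(S_t)$ is the set of admissible one-step controls $\varphi_t$ and $\mathfrak A^t(S_t)$ is the set of admissible controls $\varphi=(\varphi_t,\dots,\varphi_{T-1})$ starting at time $t$; one has $(\varphi_t,\tilde\varphi)\in\mathfrak A^t(S_t)$ iff $\varphi_t\in\mathfrak A_t(S_t)$ and $\tilde\varphi\in\mathfrak A^{t+1}(F(t,S_t,\varphi_t,Z_{t+1}))$. $S^\varphi_T$ is the terminal state generated from $S_t$ by $\varphi$, and states $S_t$ are $\mathscr F_t$-measurable. $\ell:\mathbb S\to\mathbb R^d$ is a loss function, with $\ell(S^\varphi_T)\in\mathscr L_T(\mathbb R^d)$ for admissible $\varphi$. Value functions. $\mathcal V_T(S_T)=\mathcal B_T(S_T)=\{\ell(S_T)\}$ and, for $t=0,\dots,T-1$, $$\mathcal V_t(S_t)=\Big\{\operatorname{v-sup}^t_{\theta\in\Theta}\mathbb E^\theta_t[\ell(S^\varphi_T)]:\varphi\in\mathfrak A^t(S_t)\Big\},$$ and, recursively for $t=T-1,\dots,0$, $$\mathcal B_t(S_t)=\Big\{\operatorname{v-sup}^t_{\theta\in\Theta}\mathbb E^\theta_t[X]:\varphi_t\in\mathfrak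 A_t(S_t),\ X\in\mathcal B_{t+1}(F(t,S_t,\varphi_t,Z_{t+1}))\Big\}.$$ *)

(* Defs.v *)
From HB Require Import structures.
From mathcomp Require Import all_boot all_order all_algebra.
From mathcomp Require Import all_classical all_reals all_analysis.
Import Order.TTheory GRing.Theory Num.Theory.
Import numFieldNormedType.Exports.

Set Implicit Arguments.
Unset Strict Implicit.
Unset Printing Implicit Defensive.

Local Open Scope classical_set_scope.
Local Open Scope ring_scope.

Record vector_preorder (R : realType) (d : nat)
    (le : 'rV[R]_d -> 'rV[R]_d -> Prop) : Prop := VectorPreorder {
  vpo_refl : forall x, le x x;
  vpo_trans : forall x y z, le x y -> le y z -> le x z;
  vpo_add : forall x y z, le x y -> le (x + z) (y + z);
  vpo_scale : forall (a : R) x y, 0 <= a -> le x y -> le (a *: x) (a *: y)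
}.

Definition ordering_cone (R : realType) (d : nat)
    (le : 'rV[R]_d -> 'rV[R]_d -> Prop) : set 'rV[R]_d := [set x | le 0 x].

(* Measurability between explicitly given sigma-algebras. The library's
   measurable_fun reads the sigma-algebra off the type, which is inconvenient
   for a filtration; its condition is also vacuous on a non-measurable domain,
   so the state space below is a type rather than a domain inside R^m. *)
Definition measurable_wrt (T U : Type) (G : set (set T)) (H : set (set U))
    (f : T -> U) := forall B, H B -> G (f @^-1` B).

Definition borel (U : topologicalType) : set (set U) := <<s (@open U) >>.

Definition product_salgebra (T U : Type) (G : set (set T)) (H : set (set U)) :
    set (set (T * U)) := <<s [set B `*` D | B in G & D in H] >>.

Section random_vectors.
Context {R : realType} {dO : measure_display} {Omega : measurableType dO}.

Definition coord (d : nat) (X : Omega -> 'rV[R]_d) (i : 'I_d) : Omega -> R :=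
  fun w => X w ord0 i.

Definition rvec_measurable (G : set (set Omega)) (d : nat)
    (X : Omega -> 'rV[R]_d) :=
  forall i, measurable_wrt G (@measurable _ R) (coord X i).

Definition rvec_integrable (mu : probability Omega R) (d : nat)
    (X : Omega -> 'rV[R]_d) :=
  forall i, mu.-integrable setT (EFin \o coord X i).

Definition filtration (T : nat) (Fil : nat -> set (set Omega)) :=
  [/\ forall t, (t <= T)%N -> sigma_algebra setT (Fil t),
      forall t, (t <= T)%N -> Fil t `<=` @measurable _ Omega &
      forall s t, (s <= t)%N -> (t <= T)%N -> Fil s `<=` Fil t].

Definition is_condexp (d : nat) (Q : probability Omega R)
    (G : set (set Omega)) (X Y : Omega -> 'rV[R]_d) :=
  [/\ rvec_integrable Q X, rvec_measurable G Y, rvec_integrable Q Y &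
      forall (i : 'I_d) (A : set Omega), G A ->
        (\int[Q]_(w in A) (coord Y i w)%:E =
         \int[Q]_(w in A) (coord X i w)%:E)%E].

(* Elements of L^1 are represented by functions, not by classes; equality
   of elements is almost sure equality, and inclusion of sets of elements is
   accordingly taken up to almost sure equality. *)
Definition ae_subset (P : probability Omega R) (d : nat)
    (A B : set (Omega -> 'rV[R]_d)) :=
  forall X, A X -> exists2 Y, B Y & X = Y %[ae P].

End random_vectors.

Section vector_suprema.
Context {R : realType} {dO : measure_display} {Omega : measurableType dO}.
Variables (P : probability Omega R) (Fil : nat -> set (set Omega)).
Variables (d : nat) (le : 'rV[R]_d -> 'rV[R]_d -> Prop).

Definition Lspc (t : nat) : set (Omega -> 'rV[R]_d) :=
  [set X | rvec_measurable (Fil t) X /\ rvec_integrable P X].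

Definition Lcone (t : nat) : set (Omega -> 'rV[R]_d) :=
  [set X | Lspc t X /\ {ae P, forall w, ordering_cone le (X w)}].

Definition vle (t : nat) (X Y : Omega -> 'rV[R]_d) := Lcone t (Y \- X).

(* A + L_t(C) and A - L_t(C) *)
Definition add_cone (t : nat) (A : set (Omega -> 'rV[R]_d)) :=
  [set X \+ Y | X in A & Y in Lcone t].

Definition sub_cone (t : nat) (A : set (Omega -> 'rV[R]_d)) :=
  [set X \- Y | X in A & Y in Lcone t].

Definition set_le_lower (t : nat) (A B : set (Omega -> 'rV[R]_d)) :=
  ae_subset P B (add_cone t A).

Definition set_le_upper (t : nat) (A B : set (Omega -> 'rV[R]_d)) :=
  ae_subset P A (sub_cone t B).

Definition is_vsup (I : Type) (t : nat) (X : I -> Omega -> 'rV[R]_d)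
    (V : Omega -> 'rV[R]_d) :=
  [/\ Lspc t V, forall i, vle t (X i) V &
      forall A, Lspc t A -> (forall i, vle t (X i) A) -> vle t V A].

Definition admits_suprema (T : nat) (I : Type) :=
  forall t, (t <= T)%N -> forall X : I -> Omega -> 'rV[R]_d,
    (forall i, Lspc t (X i)) -> exists V, is_vsup t X V.

(* v-sup is an arbitrary choice of a supremum, whenever there is one. *)
Definition vsup_choice (T : nat) (I : Type)
    (vsup : nat -> (I -> Omega -> 'rV[R]_d) -> Omega -> 'rV[R]_d) :=
  forall t, (t <= T)%N -> forall X : I -> Omega -> 'rV[R]_d,
    (exists V, is_vsup t X V) -> is_vsup t X (vsup t X).

(* E th t X is an arbitrary version of the conditional expectation of X under
   Q th given Fil t; it lies in L^1(Fil t, P), and the version is unique not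
   only Q th-almost surely but P-almost surely. *)
Definition condexp_family (T : nat) (I : Type) (Q : I -> probability Omega R)
    (E : I -> nat -> (Omega -> 'rV[R]_d) -> Omega -> 'rV[R]_d) :=
  forall (th : I) (t s : nat), (t <= s)%N -> (s <= T)%N ->
  forall X, Lspc s X ->
    [/\ Lspc t (E th t X), is_condexp (Q th) (Fil t) X (E th t X) &
        forall Y, is_condexp (Q th) (Fil t) X Y -> E th t X = Y %[ae P]].

Definition rectangular (T : nat) (I : Type)
    (E : I -> nat -> (Omega -> 'rV[R]_d) -> Omega -> 'rV[R]_d)
    (vsup : nat -> (I -> Omega -> 'rV[R]_d) -> Omega -> 'rV[R]_d) :=
  forall t, (t < T)%N -> forall X, Lspc T X ->
    vle t
      (vsup t (fun th => E th t (vsup t.+1 (fun th' => E th' t.+1 X))))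
      (vsup t (fun th => E th t X)).

End vector_suprema.

Section control.
Context {R : realType} {dO : measure_display} {Omega : measurableType dO}.
Variables (T : nat) (d k : nat) (SS AA I : Type).
Variables (F : nat -> SS -> AA -> 'rV[R]_k -> SS) (Z : nat -> Omega -> 'rV[R]_k).
Variable adm1 : nat -> (Omega -> SS) -> set (Omega -> AA).
Variable ell : SS -> 'rV[R]_d.
Variable E : I -> nat -> (Omega -> 'rV[R]_d) -> Omega -> 'rV[R]_d.
Variable vsup : nat -> (I -> Omega -> 'rV[R]_d) -> Omega -> 'rV[R]_d.

Definition next_state (t : nat) (S : Omega -> SS) (a : Omega -> AA) :
    Omega -> SS := fun w => F t (S w) (a w) (Z t.+1 w).

(* A control (phi_t, ..., phi_(T-1)) is the list of its T - t components; only
   the empty control starts at time T. *)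
Fixpoint admissible (t : nat) (S : Omega -> SS) (phi : seq (Omega -> AA)) :
    Prop :=
  match phi with
  | [::] => t = T
  | a :: phi' => [/\ (t < T)%N, adm1 t S a &
                     admissible t.+1 (next_state t S a) phi']
  end.

Fixpoint terminal_state (t : nat) (S : Omega -> SS)
    (phi : seq (Omega -> AA)) : Omega -> SS :=
  match phi with
  | [::] => S
  | a :: phi' => terminal_state t.+1 (next_state t S a) phi'
  end.

Definition value_fun (t : nat) (S : Omega -> SS) : set (Omega -> 'rV[R]_d) :=
  if t == T then [set ell \o S]
  else [set vsup t (fun th => E th t (ell \o terminal_state t S phi)) |
         phi in [set phi | admissible t S phi]].

(* n is the number T - t of remaining steps. *)
Fixpoint bellman_rec (n t : nat) (S : Omega -> SS) :
    set (Omega -> 'rV[R]_d) :=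
  match n with
  | 0%N => [set ell \o S]
  | n'.+1 => [set V | exists a X,
      [/\ adm1 t S a, bellman_rec n' t.+1 (next_state t S a) X &
          V = vsup t (fun th => E th t X)]]
  end.

Definition bellman_fun (t : nat) (S : Omega -> SS) :=
  bellman_rec (T - t) t S.

End control.

(* Main.v *)
From HB Require Import structures.
From mathcomp Require Import all_boot all_order all_algebra.
From mathcomp Require Import all_classical all_reals all_analysis.
From mathcomp Require Import measurable_realfun ring lra zify.
Require Import Defs.
Import Order.TTheory GRing.Theory Num.Theory.
Import numFieldNormedType.Exports.

(** Every control [phi] yields an element [b] of the Bellman set, by nesting
    the one-step operators [X |-> v-sup_th E^th_s X], and an element [v] of the
    value set, by applying the operator at time [t] once.  Both assertions
    say that [b] is below [v]: write [v = b + (v - b)] for the first and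
    [b = v - (v - b)] for the second.  The inequality is proved by backward
    induction in [bellman_value_le]: the induction hypothesis bounds the tail
    [b'] by [v'] at time [t + 1], monotonicity of the one-step operator gives
    that [b] is below the operator at [t] applied to [v'], and rectangularity
    bounds the latter by [v].

    The delicate point is that conditional expectation is monotone, that is,
    if [X] takes its values in the ordering cone [C], so does [E_t X].
    The cone is neither closed nor measurable, and for such cones this can
    fail: take for [C] the interior of a round cone together with a badly
    non-measurable set of its extreme rays.  What saves the theorem is the
    existence of suprema.

    - If there are at least two models, then the vectors [x] and [0] have a
      random supremum.  Evaluating it at a well-chosen outcome shows that any
      sequence of common upper bounds of [x] and [0] has a common upper bound
      below it, and in finite dimension this countable directedness already
      forces a least upper bound ([directed_min]).  So the ordered
      space is a finite-dimensional vector lattice up to the lineality space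
      of [C], and a maximal family of disjoint positive vectors writes [C] as a
      finite intersection of cones of total preorders ([cone_total_cones]).
      A total cone is lexicographic: it is decided by the sign of a linear
      functional, then by a total cone in the kernel.  Conditional expectation
      respects each level of this description ([condexp_closed_total]).

    - If there is only one model, [C] is arbitrary, but suprema are trivial and
      the tower property turns the inequality into an equivalence.  The same
      induction is run for the preorder of being equivalent, whose cone is a
      linear subspace, where monotonicity holds ([condexp_closed_lineality]).

    All the convex geometry rests on one separation statement,
    [nonneg_functional], and on the induction principle [face_ind] that it
    gives. *)

Set Implicit Arguments.
Unset Strict Implicit.
Unset Printing Implicit Defensive.

Local Open Scope classical_set_scope.
Local Open Scope ring_scope.

(** * Separation for convex cones that need not be closed *)

Section convex_cones.
Context {R : realType} {d : nat}.
Implicit Types (C : set 'rV[R]_d) (H A : 'M[R]_d) (x y e : 'rV[R]_d).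

Record convex_cone C : Prop := ConvexCone {
  cone0 : C 0;
  coneD : forall x y, C x -> C y -> C (x + y);
  coneZ : forall (a : R) x, 0 <= a -> C x -> C (a *: x)
}.

Definition order_unit C H e := forall x, (x <= H)%MS -> exists M, C (M *: e + x).

Lemma order_unit_ge0 C H e x : convex_cone C -> C e -> order_unit C H e ->
  (x <= H)%MS -> exists2 M, 0 <= M & C (M *: e + x).
Proof.
move=> coneC Ce unit_e /unit_e[M CM]; exists `|M|; first exact: normr_ge0.
rewrite -(subrK M `|M|) scalerDl -addrA; apply: coneD => //.
by apply: coneZ => //; rewrite subr_ge0 ler_norm.
Qed.

(** The span of [C] in [H] is found greedily, adding an element of the cone to
    [e] each time that the span grows. *)
Lemma order_unit_span C H : convex_cone C ->
  exists A e, [/\ (e <= A)%MS, (A <= H)%MS,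
                  forall x, (x <= H)%MS -> C x -> (x <= A)%MS,
                  C e & order_unit C A e].
Proof.
move=> coneC.
suff grow n A e : (\rank H - \rank A <= n)%N -> (e <= A)%MS ->
    (A <= H)%MS -> C e -> order_unit C A e ->
    exists A e, [/\ (e <= A)%MS, (A <= H)%MS,
                    forall x, (x <= H)%MS -> C x -> (x <= A)%MS,
                    C e & order_unit C A e].
  apply: (grow (\rank H) 0 0); rewrite ?leq_subr ?sub0mx//; first exact: cone0.
  move=> x; rewrite submx0 => /eqP ->; exists 0.
  by rewrite scaler0 addr0; apply: cone0.
elim: n A e => [|n IH] A e rkA eA AH Ce unit_e.
  exists A, e; split => // x xH _; apply: submx_trans xH _.
  rewrite -(mxrank_leqif_sup AH) eqn_leq mxrankS//=.
  by rewrite -subn_eq0 -leqn0.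
have [CA|/existsNP[x /not_implyP[xH /not_implyP[Cx xA]]]] :=
  pselect (forall x, (x <= H)%MS -> C x -> (x <= A)%MS); first by exists A, e.
apply: (IH (A + x)%MS (e + x)).
- suff: (\rank A < \rank (A + x)%MS)%N by move: rkA; lia.
  rewrite ltn_neqAle mxrankS ?addsmxSl// andbT.
  rewrite (mxrank_leqif_sup (addsmxSl A x)); apply/negP => AxA; apply: xA.
  by apply: submx_trans AxA; exact: addsmxSr.
- apply: addmx_sub; last exact: addsmxSr.
  by apply: submx_trans eA _; exact: addsmxSl.
- by rewrite addsmx_sub AH.
- exact: coneD.
- move=> y /sub_addsmxP[[u v] /= ->].
  have [M M0 CM] := order_unit_ge0 coneC Ce unit_e (submxMl u A).
  rewrite [v]mx11_scalar mul_scalar_mx; set s := v 0 0.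
  exists (M + `|s|).
  rewrite scalerDr [(M + _) *: e]scalerDl.
  have -> : M *: e + `|s| *: e + (M + `|s|) *: x + (u *m A + s *: x) =
     (M *: e + u *m A) + (`|s| *: e + (M + (`|s| + s)) *: x).
    by apply/rowP => i; rewrite !mxE; ring.
  apply: coneD => //; apply: coneD => //; apply: coneZ => //.
  by rewrite addr_ge0// -lerBlDr sub0r ler_normr lexx orbT.
Qed.

(** One step of the Hahn-Banach extension.  With [t] the largest real number
    such that [b - t e] lies in [C] up to closure, the line through [b - t e]
    can be added to [C] without reaching [- e]; a functional that is
    nonnegative on the larger cone and equal to 1 at [e] must take the value
    [t] at [b]. *)
Lemma cone_kill_line C H e (b : 'rV_d) : convex_cone C -> C e -> order_unit C H e ->
  ~ C (- e) -> (b <= H)%MS ->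
  exists t (C' : set 'rV_d), [/\ convex_cone C', C `<=` C', ~ C' (- e),
    C' (b - t *: e) & C' (t *: e - b)].
Proof.
move=> coneC Ce unit_e Ne bH.
have CZ a x : 0 < a -> C (a *: x) -> C x.
  move=> a0 /(coneZ coneC (a := a^-1)).
  by rewrite scalerA mulVf ?gt_eqF// scale1r invr_ge0; apply; exact: ltW.
pose S := [set t | C (b - t *: e)].
have S_down t t' : t' <= t -> S t -> S t'.
  rewrite /S /= => tt' Ct.
  have -> : b - t' *: e = (b - t *: e) + (t - t') *: e.
    by rewrite scalerBl addrA subrK.
  by apply: coneD => //; apply: coneZ => //; rewrite subr_ge0.
have S_neq0 : S !=set0.
  have [M CM] := unit_e b bH; exists (- M).
  by rewrite /S /= scaleNr opprK addrC.
have [M M0 CM] : exists2 M, 0 <= M & C (M *: e - b).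
  by apply: order_unit_ge0 coneC Ce unit_e _; rewrite eqmx_opp.
have S_ub : ubound S M.
  move=> t St; rewrite leNgt; apply/negP => Mt; apply: Ne.
  apply: (CZ (t - M)); rewrite ?subr_gt0//.
  have -> : (t - M) *: - e = (M *: e - b) + (b - t *: e).
    by apply/rowP => i; rewrite !mxE; ring.
  exact: coneD.
pose t := sup S.
have S_lt r : r < t -> S r.
  by move=> /(sup_gt S_neq0)[r' Sr' rr']; exact: S_down (ltW rr') Sr'.
have S_gt r : t < r -> ~ S r.
  move=> tr Sr; have : r <= t by apply: ub_le_sup => //; exists M.
  by rewrite leNgt tr.
pose v := b - t *: e.
exists t, [set x | exists s, C (x + s *: v)]; split.
- split.
  + by exists 0; rewrite scale0r addr0; exact: cone0.
  + move=> x y [s Cs] [s' Cs']; exists (s + s').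
    have -> : x + y + (s + s') *: v = (x + s *: v) + (y + s' *: v).
      by rewrite scalerDl addrACA.
    exact: coneD.
  + move=> a x a0 [s Cs]; exists (a * s).
    by rewrite -scalerA -scalerDr; exact: coneZ.
- by move=> x Cx; exists 0; rewrite scale0r addr0.
- move=> [s Cs].
  (* For [s < 0], adding a point [b - t' e] of [C] with [t'] just below [t]
     gives [- e] in [C]; for [s > 0], the supremum [t] is exceeded. *)
  have [s0|s0|s0] := ltgtP s 0.
  + pose r := (- s)^-1; have r0 : 0 < r by rewrite invr_gt0 oppr_gt0.
    have Cv : S (t - r / 2) by apply: S_lt; rewrite gtrBl divr_gt0.
    apply: Ne; apply: (CZ (r / 2)); first by rewrite divr_gt0.
    have -> : (r / 2) *: - e = r *: (- e + s *: v) + (b - (t - r / 2) *: e).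
      have rs : r * s = -1 by rewrite /r invrN mulNr mulVf ?lt_eqF.
      rewrite scalerDr scalerA rs /v.
      by apply/rowP => i; rewrite !mxE; field.
    by apply: coneD => //; apply: coneZ => //; exact: ltW.
  + apply: (S_gt (t + s^-1)); first by rewrite ltrDl invr_gt0.
    rewrite /S /=.
    have -> : b - (t + s^-1) *: e = s^-1 *: (- e + s *: v).
      rewrite scalerDr scalerA mulVf ?gt_eqF// /v.
      by apply/rowP => i; rewrite !mxE; ring.
    by apply: coneZ => //; rewrite invr_ge0 ltW.
  + by move: Cs; rewrite s0 scale0r addr0.
- by exists (-1); rewrite scaleN1r subrr; exact: cone0.
- by exists 1; rewrite scale1r addrC subrKA subrr; exact: cone0.
Qed.

Lemma cone_kill_lines H e (bs : seq 'rV[R]_d) C : convex_cone C -> C e ->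
  order_unit C H e -> ~ C (- e) -> (forall b, b \in bs -> (b <= H)%MS) ->
  exists C' : set 'rV_d, [/\ convex_cone C', C `<=` C', ~ C' (- e) &
    forall b, b \in bs -> exists t, C' (b - t *: e) /\ C' (t *: e - b)].
Proof.
elim: bs C => [|b bs IH] C coneC Ce unit_e Ne bsH; first by exists C; split.
have [t [C' [coneC' CC' Ne' Cb Cb']]] :=
  cone_kill_line coneC Ce unit_e Ne (bsH b (mem_head _ _)).
have [||||C'' [coneC'' CC'' Ne'' Cbs]] := IH C' coneC'.
- exact: CC'.
- by move=> x /unit_e[M CM]; exists M; exact: CC'.
- by [].
- by move=> c cbs; apply: bsH; rewrite inE cbs orbT.
exists C''; split => //; first exact: subset_trans CC''.
move=> c; rewrite inE => /orP[/eqP ->|/Cbs//].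
by exists t; split; exact: CC''.
Qed.

Lemma cone_sum C (I : finType) (P : pred I) (c : I -> 'rV[R]_d) :
  convex_cone C -> (forall i, P i -> C (c i)) -> C (\sum_(i | P i) c i).
Proof. by move=> coneC Cc; elim/big_ind: _ => //; [exact: cone0|exact: coneD]. Qed.

Definition nonneg_on C H (lam : 'cV[R]_d) :=
  forall x, (x <= H)%MS -> C x -> 0 <= (x *m lam) 0 0.

(** After killing the rows of [H] one by one, every vector of [H] is a multiple
    of [e] modulo the lineality space of the enlarged cone; the coefficient is
    the functional. *)
Lemma nonneg_functional C H : convex_cone C ->
  ~ (forall x, (x <= H)%MS -> C x) ->
  exists2 lam : 'cV[R]_d, nonneg_on C H lam & H *m lam != 0.
Proof.
move=> coneC HC.
have [A [e [eA AH CA Ce unit_e]]] := order_unit_span H coneC.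
have [HA|HA] := boolP (H <= A)%MS; last first.
  (* A functional vanishing on the span of the cone, but not on [H]. *)
  have /matrix0Pn[i [j Hij]] : H *m cokermx A != 0 by rewrite -submxE.
  exists (col j (cokermx A)).
    move=> x xH Cx; rewrite colE mulmxA -colE.
    have /eqP -> : x *m cokermx A == 0 by rewrite -submxE; exact: CA.
    by rewrite !mxE.
  apply/matrix0Pn; exists i, 0.
  by rewrite colE mulmxA -colE mxE.
have Ne : ~ C (- e).
  move=> CNe; apply: HC => x xH.
  have [M M0 CM] := order_unit_ge0 coneC Ce unit_e (submx_trans xH HA).
  rewrite -(addKr (M *: e) x) -scalerN; apply: coneD => //.
  exact: coneZ.
have [|C' [coneC' CC' Ne' Cbs]] :=
  cone_kill_lines (bs := [seq row i H | i : 'I_d]) coneC Ce unit_e Ne.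
  by move=> b /mapP[i _ ->]; apply: submx_trans HA; exact: row_sub.
have /choice[t Ct] : forall i, exists t,
    C' (row i H - t *: e) /\ C' (t *: e - row i H).
  by move=> i; apply: Cbs; apply: map_f; rewrite mem_enum.
pose lam : 'cV[R]_d := pinvmx H *m \col_i t i.
have lamE x : (x <= H)%MS ->
    C' (x - (x *m lam) 0 0 *: e) /\ C' ((x *m lam) 0 0 *: e - x).
  move=> xH; pose u := x *m pinvmx H.
  have xE : x = \sum_i u 0 i *: row i H by rewrite -mulmx_sum_row mulmxKpV.
  have lE : (x *m lam) 0 0 = \sum_i u 0 i * t i.
    by rewrite mulmxA mxE; apply: eq_bigr => i _; rewrite !mxE.
  have CZ (a : R) z : C' z -> C' (- z) -> C' (a *: z).
    move=> Cz CNz; have [a0|a0] := leP 0 a; first exact: coneZ.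
    rewrite -(opprK (a *: z)) -scalerN -scaleNr; apply: coneZ => //.
    by rewrite oppr_ge0 ltW.
  rewrite lE xE scaler_suml -!sumrB; split; apply: cone_sum => // i _;
    rewrite -scalerA -scalerBr; have [C1 C2] := Ct i; apply: CZ => //;
    by rewrite opprB.
exists lam.
  move=> x xH Cx; rewrite leNgt; apply/negP => lx0; apply: Ne'.
  have [_ /(coneD coneC' (CC' _ Cx))] := lamE x xH.
  rewrite addrCA subrr addr0.
  move=> /(coneZ coneC' (a := - ((x *m lam) 0 0)^-1)).
  rewrite scalerA mulNr mulVf ?lt_eqF// scaleN1r; apply.
  by rewrite oppr_ge0 invr_le0 ltW.
apply: contra_notN Ne' => /eqP Hlam.
have eH := submx_trans eA AH.
have [_] := lamE e eH.
have -> : e *m lam = 0.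
  by rewrite -(mulmxKpV eH) -(mulmxA (e *m pinvmx H)) Hlam mulmx0.
by rewrite mxE scale0r sub0r.
Qed.
End convex_cones.

(** * Countably directed sets and vector lattices *)

Section faces.
Context {R : realType} {d : nat}.
Implicit Types (C : set 'rV[R]_d) (H A : 'M[R]_d) (x y e : 'rV[R]_d).

(** Induction along exposed faces: if [C] does not contain [H], a functional
    that is nonnegative on the cone cuts [H] down to a smaller subspace. *)
Lemma face_ind C (K : 'M[R]_d -> Prop) : convex_cone C ->
  (forall H, (forall x, (x <= H)%MS -> C x) -> K H) ->
  (forall H lam, nonneg_on C H lam -> H *m lam != 0 ->
     K (H :&: kermx lam)%MS -> K H) ->
  forall H, K H.
Proof.
move=> coneC K0 Kstep H.
have [n] := ubnP (\rank H); elim: n H => // n IH H rkH.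
have [|HC] := pselect (forall x, (x <= H)%MS -> C x); first exact: K0.
have [lam lam0 Hlam] := nonneg_functional coneC HC.
apply: (Kstep _ lam) => //; apply: IH; apply: leq_trans (rkH : (\rank H <= n)%N).
rewrite ltn_neqAle mxrankS ?capmxSl// andbT.
rewrite (mxrank_leqif_sup (capmxSl H (kermx lam))).
apply: contra Hlam => /submx_trans /(_ (capmxSr _ _)).
by move/sub_kermxP => ->.
Qed.

Lemma mulmxB00 (lam : 'cV[R]_d) x y :
  ((x - y) *m lam) 0 0 = (x *m lam) 0 0 - (y *m lam) 0 0.
Proof. by rewrite mulmxBl [LHS]mxE [X in _ + X]mxE. Qed.

Definition countably_directed C (U : set 'rV[R]_d) :=
  U !=set0 /\ forall a : nat -> 'rV[R]_d, (forall n, U (a n)) ->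
    exists2 v, U v & forall n, C (a n - v).

(** A lower bound of a minimizing sequence of [lam] attains the infimum; the
    same argument with values tending to minus infinity shows that the infimum
    is finite. *)
Lemma functional_min C H U lam : countably_directed C U ->
  (forall u u', U u -> U u' -> (u - u' <= H)%MS) -> nonneg_on C H lam ->
  exists2 v, U v & forall u, U u -> (v *m lam) 0 0 <= (u *m lam) 0 0.
Proof.
move=> [[u0 Uu0] dirU] UH lam0.
pose f (u : 'rV[R]_d) : R := (u *m lam) 0 0.
have f_le u v : U u -> U v -> C (u - v) -> f v <= f u.
  move=> Uu Uv Cuv; have := lam0 _ (UH _ _ Uu Uv) Cuv.
  by rewrite mulmxB00 subr_ge0.
pose S := f @` U.
have S_inf : has_inf S.
  split; first by exists (f u0), u0.
  apply: contrapT => /forallNP Slb.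
  have /choice[a aP] : forall n : nat, exists u, U u /\ f u < - n%:R.
    move=> n; have /existsNP[_ /not_implyP[[u Uu <-]]] := Slb (- n%:R).
    by move/negP; rewrite -ltNge => ?; exists u.
  have [v Uv va] := dirU a (fun n => (aP n).1).
  have := f_le _ _ (aP (Num.truncn `|f v|).+1).1 Uv (va _).
  have := (aP (Num.truncn `|f v|).+1).2.
  have := truncnS_gt `|f v|.
  have : - f v <= `|f v| by rewrite ler_normr lexx orbT.
  lra.
have /choice[a aP] : forall n : nat, exists u, U u /\ f u < inf S + n.+1%:R^-1.
  move=> n; have n0 : 0 < n.+1%:R^-1 :> R by rewrite invr_gt0.
  by have [_ [u Uu <-]] := inf_adherent n0 S_inf; exists u.
have [v Uv va] := dirU a (fun n => (aP n).1).
exists v => // u Uu; apply: (@le_trans _ _ (inf S)); last first.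
  by apply: ge_inf; [case: S_inf|exists u].
apply/ler_addgt0Pr => eps eps0.
have := f_le _ _ (aP (Num.truncn eps^-1)).1 Uv (va _).
move=> /le_trans; apply; apply: le_trans (ltW (aP _).2) _.
rewrite lerD2l -[leRHS]invrK lef_pV2 ?posrE ?invr_gt0//.
exact/ltW/truncnS_gt.
Qed.

(** By [functional_min], the elements of [U] below a suitable [v] all have the
    same value under [lam], so their differences lie in the kernel of [lam] and
    [face_ind] applies. *)
Lemma directed_min C U : convex_cone C -> countably_directed C U ->
  exists2 m, U m & forall u, U u -> C (u - m).
Proof.
move=> coneC dirU.
suff: forall H U, countably_directed C U ->
    (forall u u', U u -> U u' -> (u - u' <= H)%MS) ->
    exists2 m, U m & forall u, U u -> C (u - m).
  by apply => // *; exact: submx1.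
apply: (face_ind coneC) => [H HC|H lam lam0 _ IH] {}U {}dirU UH.
  have [[m Um] _] := dirU; exists m => // u Uu.
  by apply: HC; exact: UH.
have [v Uv vmin] := functional_min dirU UH lam0.
have [|u u' [Uu Cu] [Uu' Cu']|m [Um Cm] mP] := IH (U `&` [set u | C (v - u)]).
- split; first by exists v; split => //=; rewrite subrr; exact: cone0.
  move=> a aU; have [w Uw wa] := dirU.2 a (fun n => (aU n).1).
  exists w => //; split => //=; rewrite -(subrKA (a 0%N)).
  by apply: coneD => //; exact: (aU 0%N).2.
- rewrite sub_capmx UH//=; apply/sub_kermxP.
  have fE z : U z -> C (v - z) -> z *m lam = v *m lam.
    move=> Uz Cz; apply/rowP => i; rewrite ord1; apply/eqP.
    rewrite eq_le vmin// andbT -subr_ge0.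
    have := lam0 _ (UH _ _ Uv Uz) Cz.
    by rewrite mulmxB00.
  by rewrite mulmxBl (fE u)// (fE u')// subrr.
exists m => // u Uu.
have [w Uw wP] := dirU.2 (fun n => if n is 0%N then u else v)
  (fun n => if n is 0%N as n return U (if n is 0%N then u else v) then Uu else Uv).
rewrite -(subrKA w); apply: coneD => //; first exact: (wP 0%N).
by apply: mP; split => //; exact: (wP 1%N).
Qed.

Definition has_pos_part C := forall x, exists p,
  [/\ C p, C (p - x) & forall a, C a -> C (a - x) -> C (a - p)].

(** Disjointness of positive vectors in a vector lattice, phrased without
    choosing an infimum. *)
Definition disjoint_in C x y := forall z, C (x - z) -> C (y - z) -> C (- z).

Lemma disjoint_in_sym C x y : disjoint_in C x y -> disjoint_in C y x.
Proof. by move=> xy z yz xz; exact: xy. Qed.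

Lemma disjoint_in_le C x x' y : convex_cone C -> C (x - x') ->
  disjoint_in C x y -> disjoint_in C x' y.
Proof.
move=> coneC x'x xy z zx' zy; apply: xy => //.
by rewrite -(subrKA x'); exact: coneD.
Qed.

(** The point is stability under sums: if [z <= p + q] and [z <= e], then
    [z - q] is below both [p] and [e], hence below 0, and then [z] is below
    both [q] and [e]. *)
Lemma disjoint_cone C e : convex_cone C -> C e ->
  convex_cone [set p | C p /\ disjoint_in C p e].
Proof.
move=> coneC Ce; split => /=.
- by split; [exact: cone0|move=> z; rewrite sub0r].
- move=> p q [Cp pe] [Cq qe]; split; first exact: coneD.
  move=> z zpq ze; apply: (qe) => //.
  rewrite -(opprB z q); apply: pe.
    by rewrite opprB addrCA addrC addrAC.
  have -> : e - (z - q) = (e - z) + q by rewrite opprB addrA addrAC.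
  exact: coneD.
- move=> a p a0 [Cp pe]; split; first exact: coneZ.
  have [a1|a1] := leP a 1.
    apply: (disjoint_in_le coneC _ pe).
    have -> : p - a *: p = (1 - a) *: p by rewrite scalerBl scale1r.
    by apply: coneZ; rewrite // subr_ge0.
  have {}a0 : 0 < a by exact: lt_trans ltr01 a1.
  move=> z zp ze.
  have := coneZ coneC (ltW a0) (pe (a^-1 *: z) _ _).
  rewrite scalerN scalerA mulfV ?gt_eqF// scale1r; apply.
    have -> : p - a^-1 *: z = a^-1 *: (a *: p - z).
      by rewrite scalerBr scalerA mulVf ?gt_eqF// scale1r.
    by apply: coneZ => //; rewrite invr_ge0 ltW.
  have -> : e - a^-1 *: z = a^-1 *: (e - z) + (1 - a^-1) *: e.
    by apply/rowP => i; rewrite !mxE; ring.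
  apply: coneD => //; apply: coneZ => //; first by rewrite invr_ge0 ltW.
  by rewrite subr_ge0 invf_le1// ltW.
Qed.

Definition disjoint_family C n (e : 'I_n -> 'rV[R]_d) :=
  (forall i, C (e i) /\ ~ C (- e i)) /\
  (forall i j, i != j -> disjoint_in C (e i) (e j)).

(** Disjoint non-null positive vectors are linearly independent.  Splitting a
    vanishing combination by the signs of its coefficients gives one vector
    written in two disjoint ways; it is disjoint from itself, hence null, and
    so are all its terms. *)
Lemma disjoint_family_size C n (e : 'I_n -> 'rV[R]_d) : convex_cone C ->
  disjoint_family C e -> (n <= d)%N.
Proof.
move=> coneC [Ce ee].
have /eqP <- : row_free (\matrix_i e i); last exact: rank_leq_col.
apply: inj_row_free => v; rewrite mulmx_sum_row => v0.
pose pos i := Num.max (v 0 i) 0; pose neg i := Num.max (- v 0 i) 0.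
have pos_ge0 i : 0 <= pos i by rewrite le_max lexx orbT.
have neg_ge0 i : 0 <= neg i by rewrite le_max lexx orbT.
pose u := \sum_i pos i *: e i; pose w := \sum_i neg i *: e i.
have uw : u = w.
  apply/eqP; rewrite -subr_eq0 -sumrB -[X in _ == X]v0; apply/eqP.
  apply: eq_bigr => i _; rewrite rowK -scalerBl; congr (_ *: _).
  rewrite /pos /neg; have [vi|vi] := leP (v 0 i) 0.
    by rewrite max_l ?oppr_ge0// sub0r opprK.
  by rewrite max_r ?oppr_le0 ?subr0// ltW.
have CZe i a : 0 <= a -> C (a *: e i).
  by move=> a0; apply: coneZ => //; case: (Ce i).
have disj_uw : disjoint_in C u w.
  have posneg i j : disjoint_in C (pos i *: e i) (neg j *: e j).
    have dis0 z : disjoint_in C 0 z by move=> t; rewrite sub0r.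
    have [->|ij] := eqVneq i j.
      have [vj|vj] := leP (v 0 j) 0.
        by rewrite /pos max_r// scale0r.
      apply: disjoint_in_sym; rewrite /neg max_r ?scale0r// oppr_le0; exact: ltW.
    have Pe : C (e i) /\ disjoint_in C (e i) (neg j *: e j).
      split; first by case: (Ce i).
      apply: disjoint_in_sym.
      have := coneZ (disjoint_cone coneC (proj1 (Ce i))) (neg_ge0 j) (x := e j).
      case=> //; split; first by case: (Ce j).
      by apply: ee; rewrite eq_sym.
    by have [] := coneZ (disjoint_cone coneC (CZe _ _ (neg_ge0 j))) (pos_ge0 i) Pe.
  have disj_j j : disjoint_in C u (neg j *: e j).
    have [//] : [set p | C p /\ disjoint_in C p (neg j *: e j)] u.
    apply: cone_sum; first exact: disjoint_cone (CZe _ _ (neg_ge0 j)).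
    by move=> i _; split; [exact: CZe|exact: posneg].
  have Cu : C u by apply: cone_sum => // i _; exact: CZe.
  apply: disjoint_in_sym.
  have [//] : [set p | C p /\ disjoint_in C p u] w.
  apply: cone_sum; first exact: disjoint_cone.
  by move=> j _; split; [exact: CZe|apply: disjoint_in_sym; exact: disj_j].
have CNu : C (- u) by apply: disj_uw; rewrite -?uw subrr; exact: cone0.
have le0 (a : 'I_n -> R) i : (forall j, 0 <= a j) ->
    \sum_j a j *: e j = u -> a i <= 0.
  move=> a0 au; rewrite leNgt; apply/negP => ai0; apply: (proj2 (Ce i)).
  have : C (- (a i *: e i)).
    rewrite -(addrK (\sum_(j | j != i) a j *: e j) (- (a i *: e i))).
    rewrite addrAC -opprD.
    have <- : u = a i *: e i + \sum_(j | j != i) a j *: e j.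
      by rewrite -au (bigD1 i).
    apply: coneD => //; apply: cone_sum => // j _; exact: CZe.
  move=> /(coneZ coneC (a := (a i)^-1)).
  rewrite scalerN scalerA mulVf ?gt_eqF// scale1r; apply.
  by rewrite invr_ge0 ltW.
apply/rowP => i; rewrite mxE; apply/eqP; rewrite eq_le.
have := le0 pos i pos_ge0 erefl; have := le0 neg i neg_ge0 (esym uw).
rewrite /pos /neg !ge_max oppr_le0 => /andP[-> _] /andP[-> _] //.
Qed.

(** The [x] whose negative part is disjoint from [e]. *)
Definition above_disjoint C e :=
  [set x | exists p, [/\ C p, disjoint_in C p e & C (x + p)]].

Lemma above_disjoint_cone C e : convex_cone C -> C e ->
  convex_cone (above_disjoint C e).
Proof.
move=> coneC Ce; have coneD' := disjoint_cone coneC Ce; split => /=.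
- exists 0; have [? ?] := cone0 coneD'; split => //.
  by rewrite addr0; exact: cone0.
- move=> x y [p [Cp pe xp]] [q [Cq qe yq]]; exists (p + q).
  have [? ?] := coneD coneD' (conj Cp pe) (conj Cq qe).
  by split => //; rewrite addrACA; exact: coneD.
- move=> a x a0 [p [Cp pe xp]]; exists (a *: p).
  have [? ?] := coneZ coneD' a0 (conj Cp pe).
  by split => //; rewrite -scalerDr; exact: coneZ.
Qed.

Lemma sub_above_disjoint C e x : convex_cone C -> C e -> C x ->
  above_disjoint C e x.
Proof.
move=> coneC Ce Cx; exists 0; have [? ?] := cone0 (disjoint_cone coneC Ce).
by split => //; rewrite addr0.
Qed.

(** The positive and the negative part of [x] are disjoint.  If neither were
    disjoint from [e], each would share with [e] a non-null positive lower
    bound, and the two lower bounds would contradict indecomposability. *)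
Lemma above_disjoint_total C e x : convex_cone C -> has_pos_part C -> C e ->
  (forall a b, C a -> C b -> C (e - a) -> C (e - b) -> disjoint_in C a b ->
     C (- a) \/ C (- b)) ->
  above_disjoint C e x \/ above_disjoint C e (- x).
Proof.
move=> coneC pos Ce e_atom.
have [p [Cp px pmin]] := pos x.
have dis : disjoint_in C p (p - x).
  move=> z zp zpx; have := pmin _ zp _.
  have -> : p - z - x = p - x - z by rewrite addrAC.
  by move=> /(_ zpx); rewrite addrAC subrr add0r.
have [pe|pe] := pselect (disjoint_in C p e).
  by right; exists p; split => //; rewrite addrC.
have [qe|qe] := pselect (disjoint_in C (p - x) e).
  by left; exists (p - x); split => //; rewrite addrC subrK.
exfalso.
have part q : C q -> ~ disjoint_in C q e ->
    exists a, [/\ C a, C (e - a), C (q - a) & ~ C (- a)].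
  move=> Cq /existsNP[z /not_implyP[zq /not_implyP[ze Nz]]].
  have [a [Ca az amin]] := pos z; exists a; split => //; try exact: amin.
  by move=> /(coneD coneC az); rewrite addrAC subrr add0r.
have [a [Ca ae ap Na]] := part p Cp pe.
have [b [Cb be bq Nb]] := part _ px qe.
have ab : disjoint_in C a b.
  apply: (disjoint_in_le coneC ap); apply: disjoint_in_sym.
  by apply: (disjoint_in_le coneC bq); apply: disjoint_in_sym.
by have [] := e_atom a b Ca Cb ae be ab.
Qed.

Lemma disjoint_familyS C n (e : 'I_n -> 'rV[R]_d) b : disjoint_family C e ->
  C b -> ~ C (- b) -> (forall i, disjoint_in C (e i) b) ->
  disjoint_family C (fun k : 'I_n.+1 => oapp e b (unlift ord0 k)).
Proof.
move=> [Ce ee] Cb Nb eb; split.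
  by move=> k; case: unliftP => [j|] _ /=.
move=> k l; case: unliftP => [i|] ->; case: unliftP => [j|] -> //=.
  by rewrite (inj_eq lift_inj); exact: ee.
by move=> _; apply: disjoint_in_sym.
Qed.

Lemma maximal_disjoint_family C : convex_cone C ->
  exists n (e : 'I_n -> 'rV[R]_d), disjoint_family C e /\
    forall e' : 'I_n.+1 -> 'rV[R]_d, ~ disjoint_family C e'.
Proof.
move=> coneC.
pose Q n := `[< exists e : 'I_n -> 'rV[R]_d, disjoint_family C e >].
have Q0 : exists n, Q n.
  by exists 0%N; apply/asboolP; exists (fun=> 0); split => [] [].
have Qd n : Q n -> (n <= d)%N.
  by move=> /asboolP[e]; exact: disjoint_family_size.
case: (ex_maxnP Q0 Qd) => n /asboolP[e ee] nmax.
exists n, e; split => // e' ee'.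
have /nmax : Q n.+1 by apply/asboolP; exists e'.
by rewrite ltnn.
Qed.

(** In a maximal disjoint family every member is indecomposable, since
    otherwise it could be replaced by two; this makes the cones of
    [above_disjoint] total.  A vector in all of them has a negative part disjoint
    from the whole family, which is null by maximality. *)
Lemma cone_total_cones C : convex_cone C -> has_pos_part C ->
  exists n (P : 'I_n -> set 'rV[R]_d),
    (forall i, convex_cone (P i) /\ forall x, P i x \/ P i (- x)) /\
    C = \bigcap_i P i.
Proof.
move=> coneC pos.
have [n [e [[Ce ee] e_max]]] := maximal_disjoint_family coneC.
exists n, (fun i => above_disjoint C (e i)); split.
  move=> i; have [Cei Nei] := Ce i.
  split; first exact: above_disjoint_cone.
  move=> x; apply: above_disjoint_total => // a b Ca Cb ae be ab.
  apply: contrapT => /not_orP[Na Nb].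
  pose f j := if j == i then a else e j.
  apply: (e_max (fun k => oapp f b (unlift ord0 k))).
  have fe j : C (e j - f j).
    by rewrite /f; case: eqP => [->//|_]; rewrite subrr; exact: cone0.
  apply: disjoint_familyS => //; first split.
  - by move=> j; rewrite /f; case: eqP.
  - move=> j k jk; apply: (disjoint_in_le coneC (fe j)); apply: disjoint_in_sym.
    apply: (disjoint_in_le coneC (fe k)); apply: disjoint_in_sym; exact: ee.
  - move=> j; rewrite /f; case: eqP => // /eqP ji.
    apply: disjoint_in_sym; apply: (disjoint_in_le coneC be).
    by apply: ee; rewrite eq_sym.
apply/seteqP; split => [x Cx i _|x Px].
  by apply: sub_above_disjoint => //; case: (Ce i).
have [q [Cq qx qmin]] := pos (- x).
rewrite opprK in qx.
have qe i : disjoint_in C (e i) q.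
  have [p [Cp pe xp]] := Px i I.
  apply: disjoint_in_sym; apply: (disjoint_in_le coneC _ pe).
  by apply: qmin => //; rewrite opprK addrC.
have [Nq|Nq] := pselect (C (- q)).
  by have := coneD coneC qx Nq; rewrite addrAC subrr add0r.
by case: (e_max _ (disjoint_familyS (conj Ce ee) Cq Nq qe)).
Qed.

End faces.

(** * Conditional expectations of cone-valued random vectors *)

Section sub_sigma_algebra.
Context {R : realType} {dO : measure_display} {Omega : measurableType dO}.
Variable G : set (set Omega).
Hypothesis sG : sigma_algebra setT G.

(** Turns measurability for an explicit sigma-algebra into the measurability
    of the library, on a copy of the space that carries [G]. *)
Lemma measurable_wrtE (f : Omega -> R) : measurable_wrt G measurable f <->
  measurable_fun [set: g_sigma_algebraType G] (f : g_sigma_algebraType G -> R).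
Proof.
rewrite /measurable_wrt /measurable_fun measurable_g_measurableTypeE//.
split=> [mf _ B mB|mf B mB]; first by rewrite setTI; exact: mf.
rewrite -[_ @^-1` _]setTI; apply: mf => //.
by rewrite -setC0 -setTD; case: sG => G0 GC _; exact: GC.
Qed.

Context {d : nat}.
Implicit Types (X Y W : Omega -> 'rV[R]_d) (lam : 'cV[R]_d).

Definition functional X lam w : R := (X w *m lam) 0 0.

Lemma functionalE X lam w : functional X lam w = \sum_i coord X i w * lam i 0.
Proof. by rewrite /functional mxE. Qed.

Lemma measurable_functional X lam : rvec_measurable G X ->
  measurable_wrt G measurable (functional X lam).
Proof.
move=> mX; apply/measurable_wrtE.
rewrite (_ : functional X lam = fun w => \sum_i coord X i w * lam i 0); last first.
  by apply/funext => w; exact: functionalE.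
apply: measurable_sum => i; apply: measurable_funM => //.
exact/measurable_wrtE.
Qed.

Lemma rvec_measurableB X Y : rvec_measurable G X -> rvec_measurable G Y ->
  rvec_measurable G (X \- Y).
Proof.
move=> mX mY i; apply/measurable_wrtE.
rewrite (_ : coord _ i = coord X i \- coord Y i); last first.
  by apply/funext => w; rewrite /coord !mxE.
by apply: measurable_funB; apply/measurable_wrtE.
Qed.

Lemma rvec_measurable_cst (x : 'rV[R]_d) : rvec_measurable G (cst x).
Proof. by move=> i; apply/measurable_wrtE; exact: measurable_cst. Qed.

Lemma coord_restrict X (B : set Omega) i :
  coord (patch (fun=> 0) B X) i = patch (fun=> 0) B (coord X i).
Proof.
by apply/funext => w; rewrite /coord /patch; case: ifPn; rewrite ?mxE.
Qed.

Lemma rvec_measurable_restrict X B : G B -> rvec_measurable G X ->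
  rvec_measurable G (patch (fun=> 0) B X).
Proof.
move=> GB mX i; rewrite coord_restrict; apply/measurable_wrtE.
apply/(measurable_restrict (T1 := g_sigma_algebraType G)) => //.
  by rewrite measurable_g_measurableTypeE.
apply: measurable_funTS; exact/measurable_wrtE.
Qed.

End sub_sigma_algebra.

Section conditional_expectation.
Context {R : realType} {dO : measure_display} {Omega : measurableType dO}.
Context {d : nat}.
Variables (Q : probability Omega R) (G : set (set Omega)).
Hypothesis sG : sigma_algebra setT G.
Hypothesis GM : G `<=` @measurable _ Omega.
Implicit Types (X Y W : Omega -> 'rV[R]_d) (lam : 'cV[R]_d).

Lemma integrable_functional X lam A : measurable A -> rvec_integrable Q X ->
  Q.-integrable A (EFin \o functional X lam).
Proof.
move=> mA iX; apply: (integrableS measurableT) => //.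
rewrite (_ : EFin \o _ = fun w => (\sum_i (lam i 0)%:E * (coord X i w)%:E)%E).
  by apply: integrable_sum => // i _; apply: integrableZl => //; exact: iX.
apply/funext => w /=; rewrite functionalE -sumEFin.
by apply: eq_bigr => i _; rewrite mulrC EFinM.
Qed.

Lemma integral_functional X lam A : measurable A -> rvec_integrable Q X ->
  (\int[Q]_(w in A) (functional X lam w)%:E =
   \sum_i (lam i 0)%:E * \int[Q]_(w in A) (coord X i w)%:E)%E.
Proof.
move=> mA iX.
have iXA i : Q.-integrable A (EFin \o coord X i).
  by apply: (integrableS measurableT) => //; exact: iX.
under eq_integral => w _ do rewrite functionalE -sumEFin.
rewrite integral_sum//; last first.
  move=> i; have := integrableZl mA (lam i 0) (iXA i).
  by apply: eq_integrable => // w _; rewrite /= mulrC EFinM.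
apply: eq_bigr => i _; rewrite -integralZl//; last exact: iXA.
by apply: eq_integral => w _; rewrite /= mulrC EFinM.
Qed.

Lemma condexp_functional X W lam A : is_condexp Q G X W -> G A ->
  (\int[Q]_(w in A) (functional W lam w)%:E =
   \int[Q]_(w in A) (functional X lam w)%:E)%E.
Proof.
move=> [iX _ iW XW] GA; have mA := GM GA.
rewrite !integral_functional//.
by apply: eq_bigr => i _; rewrite XW.
Qed.

Lemma rvec_integrable_restrict X B : measurable B -> rvec_integrable Q X ->
  rvec_integrable Q (patch (fun=> 0) B X).
Proof.
move=> mB iX i; rewrite coord_restrict.
have -> : EFin \o patch (fun=> 0) B (coord X i) = (EFin \o coord X i) \_ B.
  by rewrite restrict_EFin.
apply/(integrable_mkcond _ mB).
exact: integrableS (iX i).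
Qed.

Lemma integral_restrict_coord X B A i :
  (\int[Q]_(w in A) (coord (patch (fun=> 0%R) B X) i w)%:E =
   \int[Q]_(w in A `&` B) (coord X i w)%:E)%E.
Proof.
rewrite integral_mkcondr; apply: eq_integral => w _.
by rewrite coord_restrict !patchE; case: ifPn.
Qed.

Lemma sub_salgebraI A B : G A -> G B -> G (A `&` B).
Proof.
move=> GA GB; have := @measurableI _ (g_sigma_algebraType G) A B.
by rewrite measurable_g_measurableTypeE//; apply.
Qed.

Lemma condexp_restrict X W B : G B -> is_condexp Q G X W ->
  is_condexp Q G (patch (fun=> 0) B X) (patch (fun=> 0) B W).
Proof.
move=> GB [iX mW iW XW]; split.
- exact: rvec_integrable_restrict (GM GB) _.
- exact: rvec_measurable_restrict.
- exact: rvec_integrable_restrict (GM GB) _.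
- by move=> i A GA; rewrite !integral_restrict_coord XW//; exact: sub_salgebraI.
Qed.

Lemma rvec_integrableB X Y : rvec_integrable Q X -> rvec_integrable Q Y ->
  rvec_integrable Q (X \- Y).
Proof.
move=> iX iY i; have := integrableB measurableT (iX i) (iY i).
by apply: eq_integrable => // w _; rewrite /= /coord !mxE EFinB.
Qed.

Lemma integral_coordB X Y A i : measurable A -> rvec_integrable Q X ->
  rvec_integrable Q Y ->
  (\int[Q]_(w in A) (coord (X \- Y)%R i w)%:E =
   \int[Q]_(w in A) (coord X i w)%:E - \int[Q]_(w in A) (coord Y i w)%:E)%E.
Proof.
move=> mA iX iY.
rewrite -integralB_EFin//; try exact: (integrableS measurableT).
by apply: eq_integral => w _; rewrite /coord !mxE EFinB.
Qed.

Lemma condexpB X W X' W' : is_condexp Q G X W -> is_condexp Q G X' W' ->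
  is_condexp Q G (X \- X') (W \- W').
Proof.
move=> [iX mW iW XW] [iX' mW' iW' XW']; split.
- exact: rvec_integrableB.
- exact: rvec_measurableB.
- exact: rvec_integrableB.
- by move=> i A GA; have mA := GM GA; rewrite !integral_coordB// XW// XW'.
Qed.

Lemma nonneg_integral_le0 (f : Omega -> R) A : measurable A ->
  Q.-integrable A (EFin \o f) -> {ae Q, forall w, A w -> 0 <= f w} ->
  (\int[Q]_(w in A) (f w)%:E <= 0)%E -> {ae Q, forall w, A w -> f w = 0}.
Proof.
move=> mA intf f0 intf0.
have mf : measurable_fun A (EFin \o f) by exact: measurable_int intf.
have : (\int[Q]_(w in A) `|(EFin \o f) w| = 0)%E.
  apply/eqP; rewrite eq_le integral_ge0 ?andbT//.
  rewrite (ae_eq_integral (EFin \o f))//; first exact: measurableT_comp.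
  apply: filterS f0 => w /[apply] fw0.
  by rewrite /= ger0_norm.
move=> /ae_eq_integral_abs => /(_ mA mf).
by apply: filterS => w /[apply] -[].
Qed.

Lemma ae_integral_ge0 (f : Omega -> R) A : measurable A ->
  Q.-integrable A (EFin \o f) -> {ae Q, forall w, A w -> 0 <= f w} ->
  (0 <= \int[Q]_(w in A) (f w)%:E)%E.
Proof.
move=> mA intf f0; have mf := measurable_int _ intf.
rewrite (ae_eq_integral (abse \o (EFin \o f)))//.
- by apply: integral_ge0 => w _; exact: abse_ge0.
- exact: measurableT_comp.
- by apply: filterS f0 => w /[apply] fw0; rewrite /= ger0_norm.
Qed.

(** The exceptional set is required to lie in [G]: conditional expectations can
    then be modified on it, see [condexp_mono].  For a non-measurable [C] this is
    more than almost sure membership. *)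
Definition condexp_closed (C : set 'rV[R]_d) := forall X W,
  is_condexp Q G X W -> {ae Q, forall w, C (X w)} ->
  exists N, [/\ G N, Q N = 0%E & forall w, ~ N w -> C (W w)].

Lemma condexp_closed_halfspace lam :
  condexp_closed [set x | 0 <= (x *m lam) 0 0].
Proof.
move=> X W XW X0; have [iX mW iW _] := XW.
pose N := [set w | functional W lam w < 0].
have GN : G N.
  have := measurable_functional sG lam mW (measurable_itv `]-oo, 0[).
  by congr (G _); apply/seteqP; split => w /=; rewrite in_itv.
have mN := GM GN.
exists N; split => //; last by move=> w /negP; rewrite -leNgt.
have intW := integrable_functional lam mN iW.
have intNW := integrableZl mN (-1) intW.
have Wle0 : {ae Q, forall w, N w -> - functional W lam w = 0}.
  apply: nonneg_integral_le0 => //.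
  - by apply: eq_integrable intNW => // w _; rewrite /= EFinN mulN1e.
  - by apply/aeW => w; rewrite /N /= oppr_ge0 => /ltW.
  - under eq_integral => w _ do rewrite EFinN -mulN1e.
    rewrite integralZl// mulN1e oppe_le0 (condexp_functional _ XW)//.
    apply: ae_integral_ge0 => //; first exact: integrable_functional.
    by apply: filterS X0 => w X0w _; exact: X0w.
apply: measure_negligible => //; apply: negligibleS Wle0 => w Nw /(_ Nw).
by move/eqP; rewrite oppr_eq0 lt_eqF.
Qed.

Lemma condexp_closed_bigcap (I : countType) (C : I -> set 'rV[R]_d) :
  (forall i, condexp_closed (C i)) -> condexp_closed (\bigcap_i C i).
Proof.
move=> CC X W XW CX.
have /choice[N NP] : forall i, exists N,
    [/\ G N, Q N = 0%E & forall w, ~ N w -> C i (W w)].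
  by move=> i; apply: CC XW _; apply: filterS CX => w; exact.
have [G0 _ GU] := sG.
pose N' k := oapp N set0 (unpickle k).
have GN' k : G (N' k).
  by rewrite /N'; case: unpickle => //= i; case: (NP i).
exists (\bigcup_k N' k); split.
- exact: GU.
- apply: measure_negligible; first exact/GM/GU.
  apply: negligible_bigcup => k; rewrite /N'; case: unpickle => /= [i|].
    by have [GN QN _] := NP i; apply/negligibleP => //; exact: GM.
  exact: negligible_set0.
- move=> w Nw i _; have [_ _] := NP i; apply.
  by apply: contra_not Nw => Niw; exists (pickle i) => //; rewrite /N' pickleK.
Qed.

Lemma condexp_closed_subspace (H : 'M[R]_d) :
  condexp_closed [set x | (x <= H)%MS].
Proof.
pose lam (i : bool * 'I_d) := (-1) ^+ i.1 *: col i.2 (cokermx H).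
rewrite (_ : [set x | _] = \bigcap_i [set x | 0 <= (x *m lam i) 0 0]).
  by apply: condexp_closed_bigcap => i; exact: condexp_closed_halfspace.
have lamE (x : 'rV[R]_d) b j :
    (x *m lam (b, j)) 0 0 = (-1) ^+ b * (x *m cokermx H) 0 j.
  by rewrite /lam /= -scalemxAr colE mulmxA -colE mxE [X in _ * X]mxE.
apply/seteqP; split => x /=.
  rewrite submxE => /eqP xH [b j] _ /=; by rewrite lamE xH mxE mulr0.
move=> xH; rewrite submxE; apply/eqP/rowP => j; rewrite [RHS]mxE.
apply/eqP; rewrite eq_le; apply/andP; split.
  by have := xH (true, j) I; rewrite /= lamE expr1 mulN1r oppr_ge0.
by have := xH (false, j) I; rewrite /= lamE expr0 mul1r.
Qed.

Lemma condexp_closedI C C' : condexp_closed C -> condexp_closed C' ->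
  condexp_closed (C `&` C').
Proof.
move=> CC CC'; rewrite (_ : C `&` C' = \bigcap_(b : bool) if b then C else C').
  by apply: condexp_closed_bigcap => -[].
apply/seteqP; split => [x [Cx C'x] [] _ //|x Cx].
by split; [exact: (Cx true)|exact: (Cx false)].
Qed.

(** By induction along the faces of [P].  On the event [B] where the functional
    [lam] vanishes at [W], it also vanishes at [X] almost surely, because it is
    nonnegative there and has zero integral.  So the restrictions to [B] take
    their values in the smaller face. *)
Lemma condexp_closed_total P : convex_cone P -> (forall x, P x \/ P (- x)) ->
  condexp_closed P.
Proof.
move=> coneP totP.
suff KP : forall H : 'M[R]_d, condexp_closed (P `&` [set x | (x <= H)%MS]).
  have := KP 1%:M; congr condexp_closed; apply/seteqP; split => x; first by case.
  by move=> Px; split => //=; exact: submx1.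
apply: (face_ind coneP) => H.
  move=> HP; rewrite (_ : P `&` _ = [set x | (x <= H)%MS]).
    exact: condexp_closed_subspace.
  by apply/seteqP; split => [x []//|x /= xH]; split => //; exact: HP.
move=> lam lam0 Hlam IH X W XW PX; have [iX mW iW _] := XW.
have [|N1 [GN1 QN1 WN1]] := condexp_closedI (@condexp_closed_subspace H)
    (@condexp_closed_halfspace lam) XW.
  by apply: filterS PX => w [Pw Hw]; split => //; exact: lam0.
pose B := [set w | functional W lam w = 0].
have GB : G B.
  have := measurable_functional sG lam mW (measurable_set1 0).
  by congr (G _).
have mB := GM GB.
have X0 : {ae Q, forall w, B w -> functional X lam w = 0}.
  apply: nonneg_integral_le0 => //; first exact: integrable_functional.
    by apply: filterS PX => w [Pw Hw] _; exact: lam0.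
  rewrite -(condexp_functional _ XW)//.
  by rewrite integral0_eq// => w ->.
have X2 : {ae Q, forall w, (P `&` [set x | (x <= H :&: kermx lam)%MS])
    (patch (fun=> 0) B X w)}.
  apply: filterS2 PX X0 => w [Pw Hw] lamw; rewrite /patch.
  case: ifPn => [/set_mem/lamw lw0|_]; last first.
    by split; [exact: cone0|exact: sub0mx].
  split => //=; rewrite sub_capmx [X in X && _]Hw /=; apply/sub_kermxP.
  by apply/rowP => i; rewrite ord1 [RHS]mxE; exact: lw0.
have [N2 [GN2 QN2 WN2]] := IH _ _ (condexp_restrict GB XW) X2.
exists (N1 `|` N2); split.
- have := @measurableU _ (g_sigma_algebraType G) N1 N2.
  by rewrite measurable_g_measurableTypeE//; apply.
- apply: measure_negligible; first by apply: measurableU; exact: GM.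
  by apply: negligibleU; apply/negligibleP => //; exact: GM.
move=> w /not_orP[/WN1[HW lamW] /WN2 PW]; split => //.
have [lw0|lw0] := eqVneq (functional W lam w) 0.
  by move: PW; rewrite /patch mem_set// => -[].
(* Off [B] the value of [lam] at [W] is positive, so [- W] cannot be in [P]. *)
have [//|PNW] := totP (W w).
have := lam0 (- W w) _ PNW.
rewrite eqmx_opp => /(_ HW); rewrite mulNmx mxE oppr_ge0 => lamW'.
by move: lw0; rewrite /functional eq_le lamW lamW'.
Qed.

Lemma condexp_closed_pos_part C : convex_cone C -> has_pos_part C ->
  condexp_closed C.
Proof.
move=> coneC /(cone_total_cones coneC)[n [P [Ptot ->]]].
apply: condexp_closed_bigcap => i; have [coneP totP] := Ptot i.
exact: condexp_closed_total.
Qed.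

(** A cone that is its own opposite contains every span of its elements, so it
    is a linear subspace. *)
Lemma condexp_closed_lineality C : convex_cone C ->
  condexp_closed (C `&` [set x | C (- x)]).
Proof.
move=> coneC; set L := _ `&` _.
have coneL : convex_cone L.
  split.
  - by split => /=; rewrite ?oppr0; exact: cone0.
  - move=> x y [Cx CNx] [Cy CNy].
    by split => /=; rewrite ?opprD; exact: coneD.
  - move=> a x a0 [Cx CNx].
    by split => /=; rewrite -?scalerN; exact: coneZ.
have LN x : L x -> L (- x) by move=> [Cx CNx]; split => //=; rewrite opprK.
have [A [e [_ _ LA Le unit_e]]] := order_unit_span 1%:M coneL.
suff -> : L = [set x | (x <= A)%MS] by exact: condexp_closed_subspace.
apply/seteqP; split => [x Lx|x /= xA]; first by apply: LA => //; exact: submx1.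
have [M M0 LM] := order_unit_ge0 coneL Le unit_e xA.
rewrite -(addKr (M *: e) x) -scalerN; apply: coneD => //.
by apply: coneZ => //; exact: LN.
Qed.

End conditional_expectation.

(** * The almost sure order and monotonicity *)

Section preorders.
Context {R : realType} {dO : measure_display} {Omega : measurableType dO}.
Context {d : nat}.
Variables (P : probability Omega R) (T : nat) (Fil : nat -> set (set Omega)).
Hypothesis hFil : filtration T Fil.
Implicit Types (X Y Z : Omega -> 'rV[R]_d) (le : 'rV[R]_d -> 'rV[R]_d -> Prop).

Lemma ordering_cone_convex le : vector_preorder le ->
  convex_cone (ordering_cone le).
Proof.
move=> [lexx letr leD leZ]; split; rewrite /ordering_cone /=.
- exact: lexx.
- move=> x y x0 y0; apply: letr y0 _.
  by rewrite -{1}[y]add0r; exact: leD.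
- by move=> a x a0 x0; rewrite -[0](scaler0 _ a); exact: leZ.
Qed.

Lemma LspcB t X Y : (t <= T)%N -> Lspc P Fil t X -> Lspc P Fil t Y ->
  Lspc P Fil t (X \- Y).
Proof.
move=> tT [mX iX] [mY iY]; have [sF _ _] := hFil.
split; first by apply: (rvec_measurableB (sF _ tT)).
exact: rvec_integrableB.
Qed.

Lemma Lspc_cst t (x : 'rV[R]_d) : (t <= T)%N -> Lspc P Fil t (cst x).
Proof.
move=> tT; have [sF _ _] := hFil; split.
  exact: (rvec_measurable_cst (sF _ tT)).
move=> i.
exact: eq_integrable (finite_measure_integrable_cst P (x 0 i) measurableT).
Qed.

Lemma vle_refl le t X : vector_preorder le -> (t <= T)%N ->
  vle P Fil le t X X.
Proof.
move=> hle tT; rewrite /vle (_ : X \- X = cst 0); last first.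
  by apply/funext => w /=; rewrite subrr.
split; first exact: Lspc_cst.
by apply/aeW => w; exact: cone0 (ordering_cone_convex hle).
Qed.

Lemma vle_ae_eq le t X Y : vector_preorder le -> (t <= T)%N ->
  Lspc P Fil t X -> Lspc P Fil t Y -> X = Y %[ae P] -> vle P Fil le t X Y.
Proof.
move=> hle tT LX LY XY; split; first exact: LspcB.
apply: filterS XY => w /(_ I) XYw /=; rewrite XYw subrr.
exact: cone0 (ordering_cone_convex hle).
Qed.

Lemma vle_trans le t X Y Z : vector_preorder le -> (t <= T)%N ->
  Lspc P Fil t X -> Lspc P Fil t Z ->
  vle P Fil le t X Y -> vle P Fil le t Y Z -> vle P Fil le t X Z.
Proof.
move=> hle tT LX LZ [_ XY] [_ YZ]; split; first exact: LspcB.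
apply: filterS2 XY YZ => w XYw YZw /=.
rewrite -(subrKA (Y w)); exact: (coneD (ordering_cone_convex hle)).
Qed.

Lemma ae_exists (A : set Omega) : {ae P, forall w, A w} -> exists w, A w.
Proof.
move=> PA; apply: contrapT => /forallNP NA.
have : P setT = 0%E.
  by apply: measure_negligible => //; apply: negligibleS PA => w _; exact: NA.
by rewrite probability_setT => /eqP; rewrite eqe oner_eq0.
Qed.

(** The supremum [V] of the constants [x] and 0 is random.  Given a sequence of
    constant upper bounds, almost every value of [V] is an upper bound below
    all of them.  There are too many constant upper bounds to treat all of them
    at once, which is why [directed_min] asks for sequences only. *)
Lemma pos_part_of_suprema le (I : Type) (i j : I) : vector_preorder le ->
  admits_suprema P Fil le T I -> i <> j -> has_pos_part (ordering_cone le).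
Proof.
move=> hle sup ij x; set C := ordering_cone le.
have coneC := ordering_cone_convex hle.
pose X k : Omega -> 'rV[R]_d := cst (if `[< k = i >] then x else 0).
have [V [_ XV Vmin]] := sup 0%N (leq0n T) X (fun=> Lspc_cst _ (leq0n T)).
have XiV : {ae P, forall w, C (V w - x)}.
  by have [_] := XV i; rewrite /X asboolT.
have XjV : {ae P, forall w, C (V w)}.
  have [_] := XV j; rewrite /X asboolF; last exact/nesym.
  by apply: filterS => w /=; rewrite subr0.
pose U := [set a | C a /\ C (a - x)].
have [|m [Cm Cmx] mmin] := @directed_min _ _ C U coneC.
  split.
    have [w [Cw Cxw]] : exists w, C (V w) /\ C (V w - x).
      by apply: ae_exists; apply: filterS2 XjV XiV.
    by exists (V w).
  move=> a Ua.
  have Va n : {ae P, forall w, C (a n - V w)}.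
    have [|//] := Vmin (cst (a n)) (Lspc_cst _ (leq0n T)).
    move=> k; have [Ca Cax] := Ua n; split.
      by apply: LspcB => //; exact: Lspc_cst.
    by apply/aeW => w; rewrite /X /=; case: ifP => _; rewrite ?subr0.
  have [w [[Cw Cxw] aw]] : exists w, (C (V w) /\ C (V w - x)) /\
      forall n, C (a n - V w).
    apply: ae_exists; apply: filterS2 (ae_foralln Va).
      by move=> w Vw; split; first exact: Vw.
    by apply: filterS2 XjV XiV.
  by exists (V w).
by exists m; split => // a Ca Cax; exact: mmin.
Qed.

Section monotonicity.
Variables (I : Type) (Q : I -> probability Omega R).
Variable E : I -> nat -> (Omega -> 'rV[R]_d) -> Omega -> 'rV[R]_d.
Hypothesis hQ : forall th, Q th `<< P.
Hypothesis hE : condexp_family P Fil T Q E.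

(** Membership in the cone holds outside of a [Q th]-null set of [Fil t] only.
    Setting the conditional expectation to 0 on that set gives another version,
    and versions agree [P]-almost surely, so membership holds [P]-almost
    surely. *)
Lemma condexp_mono le th t s X Y : vector_preorder le ->
  condexp_closed (Q th) (Fil t) (ordering_cone le) ->
  (t <= s)%N -> (s <= T)%N -> Lspc P Fil s X -> Lspc P Fil s Y ->
  vle P Fil le s X Y -> vle P Fil le t (E th t X) (E th t Y).
Proof.
move=> hle QC ts sT LX LY [LYX XY].
have tT := leq_trans ts sT; have [sF FM _] := hFil.
have [LEX XE _] := hE th ts sT LX; have [LEY YE _] := hE th ts sT LY.
split; first exact: LspcB.
have DE := condexpB (sF t tT) (FM t tT) YE XE.
have QXY : {ae Q th, forall w, ordering_cone le ((Y \- X) w)}.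
  have [N [mN PN NXY]] := XY; exists N; split => //.
  have /(hQ th) : P.-null_set N by apply: negligible_null_set; exact/negligibleP.
  exact.
have [N [FN QN NC]] := QC _ _ DE QXY.
have [_ _ uniq] := hE th ts sT LYX.
have FNC : Fil t (~` N) by rewrite -setTD; case: (sF t tT) => _ FC _; exact: FC.
pose W := patch (fun=> 0) (~` N) (E th t Y \- E th t X).
have WE : is_condexp (Q th) (Fil t) (Y \- X) W.
  have [iYX mD iD DYX] := DE; split => //.
  - exact: (rvec_measurable_restrict (sF _ tT)).
  - by apply: rvec_integrable_restrict => //; exact: FM FNC.
  - move=> i A FA; rewrite -DYX// integral_restrict_coord -setDE.
    have mA := FM t tT _ FA; have mN := FM t tT _ FN.
    by rewrite -(negligible_integral mN mA _ QN)//; exact: integrableS (iD i).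
apply: filterS2 (uniq _ DE) (uniq _ WE) => w /(_ Logic.I) <- /(_ Logic.I) ->.
rewrite /W /patch; case: ifPn => [/set_mem|_]; first exact: NC.
exact: cone0 (ordering_cone_convex hle).
Qed.

Lemma condexp_tower th s t X : (s <= t)%N -> (t <= T)%N ->
  Lspc P Fil T X -> E th s (E th t X) = E th s X %[ae P].
Proof.
move=> st tT LX; have [sF FM FS] := hFil.
have [LEX [iX _ _ XE] _] := hE th tT (leqnn T) LX.
have [_ [_ mY iY YE] _] := hE th st tT LEX.
have [_ _ uniq] := hE th (leq_trans st tT) (leqnn T) LX.
apply: ae_eq_sym; apply: uniq; split => // i A FA.
by rewrite YE// XE//; exact: FS FA.
Qed.

End monotonicity.
End preorders.

(** * Backward induction *)

Section dynamic_programming.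
Context {R : realType} {dO : measure_display} {Omega : measurableType dO}.
Context {d k : nat}.
Variables (P : probability Omega R) (T : nat) (Fil : nat -> set (set Omega)).
Hypothesis hFil : filtration T Fil.
Variables (I SS AA : Type) (le : 'rV[R]_d -> 'rV[R]_d -> Prop).
Hypothesis hle : vector_preorder le.
Variable E : I -> nat -> (Omega -> 'rV[R]_d) -> Omega -> 'rV[R]_d.
Variable vsup : nat -> (I -> Omega -> 'rV[R]_d) -> Omega -> 'rV[R]_d.
Variables (F : nat -> SS -> AA -> 'rV[R]_k -> SS) (Z : nat -> Omega -> 'rV[R]_k).
Variable adm1 : nat -> (Omega -> SS) -> set (Omega -> AA).
Variable ell : SS -> 'rV[R]_d.
Local Notation Lspc := (Lspc P Fil).
Local Notation vle := (vle P Fil le).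

Hypothesis vsupP : forall t X, (t <= T)%N -> (forall th, Lspc t (X th)) ->
  is_vsup P Fil le t X (vsup t X).
Hypothesis LspcE : forall th t s X, (t <= s)%N -> (s <= T)%N -> Lspc s X ->
  Lspc t (E th t X).
Hypothesis E_mono : forall th t s X Y, (t <= s)%N -> (s <= T)%N ->
  Lspc s X -> Lspc s Y -> vle s X Y -> vle t (E th t X) (E th t Y).
Hypothesis rect : rectangular P Fil le T E vsup.

Definition upper_exp t X := vsup t (fun th => E th t X).

Lemma Lspc_upper_exp t s X : (t <= s)%N -> (s <= T)%N -> Lspc s X ->
  Lspc t (upper_exp t X).
Proof.
move=> ts sT LX; have tT := leq_trans ts sT.
by have [] := vsupP tT (fun th => LspcE th ts sT LX).
Qed.

Lemma upper_exp_mono t s X Y : (t <= s)%N -> (s <= T)%N ->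
  Lspc s X -> Lspc s Y -> vle s X Y -> vle t (upper_exp t X) (upper_exp t Y).
Proof.
move=> ts sT LX LY XY; have tT := leq_trans ts sT.
have [_ _ Xmin] := vsupP tT (fun th => LspcE th ts sT LX).
have [LVY YV _] := vsupP tT (fun th => LspcE th ts sT LY).
apply: Xmin => // th.
apply: (vle_trans hFil hle tT _ LVY (E_mono th ts sT LX LY XY) (YV th)).
exact: LspcE ts sT LX.
Qed.

Fixpoint bellman_value t (S : Omega -> SS) phi : Omega -> 'rV[R]_d :=
  match phi with
  | [::] => ell \o S
  | a :: phi' => upper_exp t (bellman_value t.+1 (next_state F Z t S a) phi')
  end.

Lemma bellman_recP n t S V : (t + n)%N = T ->
  bellman_rec F Z adm1 ell E vsup n t S V <->
  exists2 phi, admissible T F Z adm1 t S phi & V = bellman_value t S phi.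
Proof.
elim: n t S V => [|n IH] t S V tnT.
  rewrite addn0 in tnT; split => [->|[[|a phi] /=]]; first by exists [::].
    by move=> _ ->.
  by rewrite tnT ltnn => -[].
rewrite addnS -addSn in tnT; split => /=.
  move=> [a [X [aS /(IH _ _ _ tnT)[phi phiS ->] ->]]].
  exists (a :: phi) => //; split => //.
  by rewrite -tnT leq_addr.
move=> [[|a phi] /= phiS ->]; first by exfalso; move: tnT; lia.
have [_ aS {}phiS] := phiS.
exists a, (bellman_value t.+1 (next_state F Z t S a) phi); split => //.
by apply/(IH _ _ _ tnT); exists phi.
Qed.

Lemma Lspc_bellman_value t S phi : (t <= T)%N ->
  admissible T F Z adm1 t S phi -> Lspc T (ell \o terminal_state F Z t S phi) ->
  Lspc t (bellman_value t S phi).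
Proof.
elim: phi t S => [|a phi IH] t S tT /= => [->//|[tT' _ phiS] LX].
by apply: Lspc_upper_exp (IH _ _ tT' phiS LX).
Qed.

Lemma bellman_value_le t S phi : (t < T)%N ->
  admissible T F Z adm1 t S phi -> Lspc T (ell \o terminal_state F Z t S phi) ->
  vle t (bellman_value t S phi)
        (upper_exp t (ell \o terminal_state F Z t S phi)).
Proof.
elim: phi t S => [|a phi IH] t S /= tT => [tE|[_ aS phiS] LX].
  by move: tT; rewrite tE ltnn.
(* For [t = T - 1] both sides are the same term. *)
have [t1T|t1T] := ltnP t.+1 T; last first.
  have t1E : t.+1 = T by apply/eqP; rewrite eqn_leq tT.
  case: phi phiS LX {IH} => [_ _ /=|b phi /= []]; first exact: vle_refl (ltnW tT).
  by rewrite t1E ltnn.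
have LB := Lspc_bellman_value tT phiS LX.
have LV := Lspc_upper_exp tT (leqnn T) LX.
apply: (vle_trans hFil hle (ltnW tT) _ _ _ (rect tT LX)).
- exact: Lspc_upper_exp LB.
- exact: Lspc_upper_exp (ltnW tT) (leqnn T) LX.
- by apply: upper_exp_mono (leqnSn t) tT LB LV _; exact: IH.
Qed.

End dynamic_programming.

(** * The case of a single model *)

Section single_model.
Context {R : realType} {dO : measure_display} {Omega : measurableType dO}.
Context {d : nat}.
Variables (P : probability Omega R) (T : nat) (Fil : nat -> set (set Omega)).
Hypothesis hFil : filtration T Fil.
Variables (I : Type) (th0 : I) (Q : I -> probability Omega R).
Hypothesis th0_only : forall th, th = th0.
Variable E : I -> nat -> (Omega -> 'rV[R]_d) -> Omega -> 'rV[R]_d.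
Hypothesis hE : condexp_family P Fil T Q E.
Variable le : 'rV[R]_d -> 'rV[R]_d -> Prop.
Hypothesis hle : vector_preorder le.
Variable vsup : nat -> (I -> Omega -> 'rV[R]_d) -> Omega -> 'rV[R]_d.
Hypothesis vsupP : forall t X, (t <= T)%N -> (forall th, Lspc P Fil t (X th)) ->
  is_vsup P Fil le t X (vsup t X).

Definition le_equiv (x y : 'rV[R]_d) := le x y /\ le y x.

Lemma le_equiv_preorder : vector_preorder le_equiv.
Proof.
case: hle => lexx letr leD leZ; split.
- by move=> x; split.
- by move=> x y z [xy yx] [yz zy]; split; [exact: letr yz|exact: letr yx].
- by move=> x y z [xy yx]; split; exact: leD.
- by move=> a x y a0 [xy yx]; split; exact: leZ.
Qed.

Lemma ordering_cone_equiv : ordering_cone le_equiv =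
  ordering_cone le `&` [set x | ordering_cone le (- x)].
Proof.
case: hle => lexx letr leD leZ.
apply/seteqP; split => x [x0 Nx] /=; split => //; rewrite /ordering_cone /=.
  by have := leD _ _ (- x) Nx; rewrite subrr add0r.
by have := leD _ _ x Nx; rewrite addNr add0r.
Qed.

Lemma vle_equiv t X Y : (t <= T)%N -> vle P Fil le_equiv t X Y <->
  vle P Fil le t X Y /\ vle P Fil le t Y X.
Proof.
move=> tT; rewrite /vle /Lcone ordering_cone_equiv; split.
  move=> [LD C2]; split; split=> //; first by apply: filterS C2 => w [].
    rewrite (_ : X \- Y = cst 0 \- (Y \- X)); last first.
      by apply/funext => w /=; rewrite sub0r opprB.
    by apply: (LspcB hFil tT) LD; exact: (Lspc_cst _ hFil).
  by apply: filterS C2 => w [_] /=; rewrite opprB.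
move=> [[LYX C1] [LXY C2]]; split => //.
by apply: filterS2 C1 C2 => w C1w C2w; split => //=; rewrite opprB.
Qed.

Lemma is_vsup_equiv t X : (t <= T)%N -> (forall th, Lspc P Fil t (X th)) ->
  is_vsup P Fil le_equiv t X (vsup t X).
Proof.
move=> tT LX; have [LV XV Vmin] := vsupP tT LX.
have VX th : vle P Fil le t (vsup t X) (X th).
  apply: Vmin => // th'; rewrite (th0_only th') (th0_only th).
  exact: (vle_refl P hFil).
have XV2 th : vle P Fil le_equiv t (X th) (vsup t X) by apply/vle_equiv.
split => // A LA /(_ th0)/(vle_equiv _ _ tT)[XA AX]; apply/vle_equiv => //; split.
- exact (vle_trans hFil hle tT LV LA (VX th0) XA).
- exact (vle_trans hFil hle tT LA LV AX (XV th0)).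
Qed.

Hypothesis hQ : forall th, Q th `<< P.

Lemma condexp_mono_equiv th t s X Y : (t <= s)%N -> (s <= T)%N ->
  Lspc P Fil s X -> Lspc P Fil s Y ->
  vle P Fil le_equiv s X Y -> vle P Fil le_equiv t (E th t X) (E th t Y).
Proof.
move=> ts sT LX LY XY; have [sF FM _] := hFil; have tT := leq_trans ts sT.
apply: (condexp_mono hFil hQ hE le_equiv_preorder _ ts sT) => //.
rewrite ordering_cone_equiv.
apply: condexp_closed_lineality (sF t tT) (FM t tT) _ _.
exact: ordering_cone_convex.
Qed.

(** With one model a supremum is equivalent to the vector itself, so this is the
    tower property. *)
Lemma rectangular_equiv : rectangular P Fil le_equiv T E vsup.
Proof.
move=> t tT X LX; have tT' := ltnW tT.
have LE th s : (s <= T)%N -> Lspc P Fil s (E th s X).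
  by move=> sT; have [] := hE th sT (leqnn T) LX.
pose B := vsup t.+1 (fun th' => E th' t.+1 X).
have [LB EB Bmin] := is_vsup_equiv tT (fun th => LE th _ tT).
have LEB th : Lspc P Fil t (E th t B) by have [] := hE th (leqnSn t) tT LB.
have [LV EV Vmin] := is_vsup_equiv tT' (fun th => LE th _ tT').
have [_ _ Wmin] := is_vsup_equiv tT' LEB.
apply: Wmin => // th.
have BE : vle P Fil le_equiv t.+1 B (E th t.+1 X).
  apply: Bmin; first exact: LE.
  move=> th'; rewrite (th0_only th') (th0_only th).
  exact: (vle_refl P hFil _ le_equiv_preorder tT).
have EBE := condexp_mono_equiv th (leqnSn t) tT LB (LE th _ tT) BE.
apply: (vle_trans hFil le_equiv_preorder tT' (LEB th) LV EBE).
have LEE : Lspc P Fil t (E th t (E th t.+1 X)).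
  by have [] := hE th (leqnSn t) tT (LE th _ tT).
apply: (vle_trans hFil le_equiv_preorder tT' LEE LV _ (EV th)).
apply: (vle_ae_eq hFil le_equiv_preorder tT' LEE (LE th _ tT')).
exact (condexp_tower hFil hE th (leqnSn t) tT LX).
Qed.

End single_model.

(** * Comparison of the Bellman and value sets *)

Theorem theorem3p7
  (R : realType) (d m k : nat)
  (dO : measure_display) (Omega : measurableType dO)
  (P : probability Omega R)
  (T : nat) (Fil : nat -> set (set Omega)) (hFil : filtration T Fil)
  (Theta : set 'rV[R]_d) (Theta_fin : finite_set Theta)
  (Theta_neq0 : Theta !=set0)
  (Q : Theta -> probability Omega R) (hQ : forall th, Q th `<< P)
  (E : Theta -> nat -> (Omega -> 'rV[R]_d) -> Omega -> 'rV[R]_d)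
  (hE : condexp_family P Fil T Q E)
  (le : 'rV[R]_d -> 'rV[R]_d -> Prop) (hle : vector_preorder le)
  (vsup : nat -> (Theta -> Omega -> 'rV[R]_d) -> Omega -> 'rV[R]_d)
  (hvsup : vsup_choice P Fil le T vsup)
  (SS : set 'rV[R]_m) (U : topologicalType) (AA : set U) (hAA : compact AA)
  (F : nat -> SS -> AA -> 'rV[R]_k -> SS)
  (hF : forall t, (t < T)%N ->
    measurable_wrt
      (product_salgebra
         (product_salgebra (borel (U := SS)) (borel (U := AA)))
         (borel (U := 'rV[R]_k)))
      (borel (U := SS))
      (fun x => F t x.1.1 x.1.2 x.2))
  (Z : nat -> Omega -> 'rV[R]_k)
  (hZ : forall t, rvec_measurable measurable (Z t))
  (adm1 : nat -> (Omega -> SS) -> set (Omega -> AA))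
  (hstate : forall t (S : Omega -> SS) (a : Omega -> AA), (t < T)%N ->
    measurable_wrt (Fil t) (borel (U := SS)) S -> adm1 t S a ->
    measurable_wrt (Fil t.+1) (borel (U := SS)) (next_state F Z t S a))
  (ell : SS -> 'rV[R]_d) :
  admits_suprema P Fil le T Theta ->
  rectangular P Fil le T E vsup ->
  forall (t : nat) (S : Omega -> SS), (t < T)%N ->
    measurable_wrt (Fil t) (borel (U := SS)) S ->
    (forall phi, admissible T F Z adm1 t S phi ->
      Lspc P Fil T (ell \o terminal_state F Z t S phi)) ->
    set_le_lower P Fil le t (bellman_fun T F Z adm1 ell E vsup t S)
                            (value_fun T F Z adm1 ell E vsup t S) /\
    set_le_upper P Fil le t (bellman_fun T F Z adm1 ell E vsup t S)
                            (value_fun T F Z adm1 ell E vsup t S).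
Proof.
move=> sup rect t S tT _ LS; have [sF FM _] := hFil.
have vsupP s X : (s <= T)%N -> (forall th, Lspc P Fil s (X th)) ->
    is_vsup P Fil le s X (vsup s X).
  by move=> sT LX; apply: hvsup => //; exact: sup.
have LspcE th r s X : (r <= s)%N -> (s <= T)%N -> Lspc P Fil s X ->
    Lspc P Fil r (E th r X).
  by move=> rs sT LX; have [] := hE th _ _ rs sT _ LX.
have B_le_V phi : admissible T F Z adm1 t S phi ->
    vle P Fil le t (bellman_value E vsup F Z ell t S phi)
      (vsup t (fun th => E th t (ell \o terminal_state F Z t S phi))).
  move=> phiS; have LX := LS _ phiS.
  have [[i [j ij]]|one] := pselect (exists i j : Theta, i <> j).
    have pos := pos_part_of_suprema hFil hle sup ij.
    apply: (bellman_value_le hFil hle vsupP LspcE _ rect tT phiS LX).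
    move=> th r s X Y rs sT LX' LY XY; have rT := leq_trans rs sT.
    apply: (condexp_mono hFil hQ hE hle _ rs sT LX' LY XY).
    apply: (condexp_closed_pos_part (sF _ rT) (FM _ rT)) pos.
    exact: ordering_cone_convex.
  have [x0 Tx0] := Theta_neq0; pose th0 : Theta := exist _ x0 (mem_set Tx0).
  have only th : th = th0.
    by apply: contrapT => ne; apply: one; exists th, th0.
  have [] := bellman_value_le hFil (le_equiv_preorder hle)
    (is_vsup_equiv hFil only hle vsupP) LspcE
    (condexp_mono_equiv hFil hE hle hQ)
    (rectangular_equiv hFil only hE hle vsupP hQ) tT phiS LX.
  by move=> LD C2; split => //; apply: filterS C2 => w [].
have tTE : (t + (T - t))%N = T by rewrite subnKC// ltnW.
have BP V := bellman_recP E vsup F Z adm1 ell S V tTE.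
rewrite /set_le_lower /set_le_upper /value_fun ltn_eqF//; split.
  move=> _ [phi phiS <-]; set V := vsup _ _.
  set b := bellman_value E vsup F Z ell t S phi.
  exists (b \+ (V \- b)).
    exists b; first by apply/BP; exists phi.
    by exists (V \- b) => //; exact: B_le_V.
  by apply/aeW => w _ /=; rewrite addrC subrK.
move=> _ /BP[phi phiS ->].
set b := bellman_value E vsup F Z ell t S phi.
pose V := vsup t (fun th => E th t (ell \o terminal_state F Z t S phi)).
exists (V \- (V \- b)).
  exists V; first by exists phi.
  by exists (V \- b) => //; exact: B_le_V.
by apply/aeW => w _ /=; rewrite opprB addrC subrK.
Qed.
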